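(* Let $T$ be a probability-preserving ergodic map on a space $(X,m)$. Let $f : X\to\mathbb{R}$ be measurable and write $S_n f = \sum_{k=0}^{n-1} f\circ T^k$. Let $(r(n))_{n\in\mathbb{N}}$ be a sequence of positive real numbers. Assume that the Birkhoff sums $S_n f$ satisfy an almost sure limit theorem with rate $r$ for the measure $m$: the process $(S_n f)_{n\in\mathbb{N}}$ on $(X,m)$ can be coupled with a process $(W_n)_{n\in\mathbb{N}}$, defined on some probability space $(\Omega,\mathbb{P}_W)$, such that, almost surely, $|S_n f - W_n| = o(r(n))$. Let $m'$ be a probability measure on $X$ which is absolutely continuous with respect to $m$. Assume moreover that, for $m$-almost every $x$, $f(T^n x) = o(r(n))$ as $n\to\infty$. Then $S_n f$ can also be coupled with $W_n$ for the measure $m'$, with the same almost sure rate $r$: the process $(S_n f)_{n\in\mathbb{N}}$ on $(X,m')$ can be coupled with $(W_n)_{n\in\mathbb{N}}$ so that, almost surely, $|S_n f - W_n| = o(r(n))$.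
   Context: Here $(X,m)$ is a probability space, and $T : X\to X$ is measurable, preserves $m$, and is ergodic for $m$. Almost sure limit theorem with rate $r(n)$: given two processes $(Z^1_n)_{n\in\mathbb{N}}$ and $(Z^2_n)_{n\in\mathbb{N}}$ defined on probability spaces $(\Omega_1,\mathbb{P}_1)$ and $(\Omega_2,\mathbb{P}_2)$, with values in the same metric space with distance $d$ (here $\mathbb{R}$ with its usual distance), an almost sure limit theorem with rate $r(n)$ between them is a coupling between the two processes, i.e. a measure $\mathbb{P}$ on $\Omega_1\times\Omega_2$ whose marginals are $\mathbb{P}_1$ and $\mathbb{P}_2$, such that for $\mathbb{P}$-almost every $(\omega_1,\omega_2)$ one has $d(Z^1_n(\omega_1),Z^2_n(\omega_2)) = o(r(n))$ as $n\to\infty$. In the hypothesis this is used with $(\Omega_1,\mathbb{P}_1)=(X,m)$, and in the conclusion with $(\Omega_1,\mathbb{P}_1)=(X,m')$; in both cases $Z^1_n = S_n f$, $(\Omega_2,\mathbb{P}_2)=(\Omega,\mathbb{P}_W)$ and $Z^2_n=W_n$. *)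

(* Defs.v *)
From HB Require Import structures.
From mathcomp Require Import all_boot all_order all_algebra.
From mathcomp Require Import all_classical all_reals all_analysis.
Import Order.TTheory GRing.Theory Num.Theory.
Import numFieldNormedType.Exports.

Set Implicit Arguments.
Unset Strict Implicit.
Unset Printing Implicit Defensive.

Local Open Scope classical_set_scope.
Local Open Scope ring_scope.

Definition measure_preserving (d : measure_display) (X : measurableType d)
    (R : realType) (m : probability X R) (T : {mfun X >-> X}) : Prop :=
  forall A : set X, measurable A -> m (T @^-1` A) = m A.

Definition ergodic (d : measure_display) (X : measurableType d)
    (R : realType) (m : probability X R) (T : {mfun X >-> X}) : Prop :=
  forall A : set X, measurable A -> T @^-1` A = A ->
    m A = 0%E \/ m A = 1%E.

Definition birkhoff_sum (X : Type) (R : realType) (T : X -> X) (f : X -> R)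
    (n : nat) (x : X) : R :=
  \sum_(0 <= k < n) f (iter k T x).

Definition coupling (d1 d2 : measure_display) (Omega1 : measurableType d1)
    (Omega2 : measurableType d2) (R : realType)
    (P1 : probability Omega1 R) (P2 : probability Omega2 R)
    (P : probability (Omega1 * Omega2)%type R) : Prop :=
  (forall A : set Omega1, measurable A -> pushforward P fst A = P1 A) /\
  (forall B : set Omega2, measurable B -> pushforward P snd B = P2 B).

Definition almost_sure_limit_theorem (d1 d2 : measure_display)
    (Omega1 : measurableType d1) (Omega2 : measurableType d2) (R : realType)
    (P1 : probability Omega1 R) (P2 : probability Omega2 R)
    (Z1 : nat -> Omega1 -> R) (Z2 : nat -> Omega2 -> R) (r : nat -> R) : Prop :=
  exists P : probability (Omega1 * Omega2)%type R,
    coupling P1 P2 P /\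
    {ae P, forall w : Omega1 * Omega2,
      (fun n : nat => `|Z1 n w.1 - Z2 n w.2|) =o_\oo r}.

(* Main.v *)
(** Let g be the density of m' with respect to m. The filling scheme moves the
    mass of m forward along T towards m': at time k, the mass not yet settled,
    pushed by T^k, settles wherever and as much as the part of g not yet filled
    allows. Mass that never settles avoids the set where g is never filled; by
    ergodicity this set or this mass is null, and then both are, because they
    always carry the same total. So m' is the law of T^tau x for x of law m and
    a randomized time tau. If (x, w) follows the given coupling then
    (T^tau x, w) follows the required one; since tau is applied on the X side,
    nothing has to be disintegrated. Finally S_n f o T^k - S_n f = o(r(n))
    almost surely, since S_n f o T - S_n f = f o T^n - f and f = o(r(n)): either
    r tends to infinity, or f = 0 almost everywhere. *)

Require Import Defs.
From HB Require Import structures.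
From mathcomp Require Import all_boot all_order all_algebra.
From mathcomp Require Import all_classical all_reals all_analysis.
From mathcomp Require Import measurable_realfun.
Import Order.TTheory GRing.Theory Num.Theory.
Import numFieldNormedType.Exports.

Set Implicit Arguments.
Unset Strict Implicit.
Unset Printing Implicit Defensive.

Local Open Scope classical_set_scope.
Local Open Scope ring_scope.

(** * Densities, their transport by a nonsingular map, and partial absorption *)

Lemma density_measure_exists (d : measure_display) (X : measurableType d)
    (R : realType) (mu : {measure set X -> \bar R}) (w : X -> \bar R) :
  measurable_fun setT w -> (forall x, 0 <= w x)%E ->
  exists nu : {measure set X -> \bar R},
    forall A, nu A = (\int[mu]_(x in A) w x)%E.
Proof.
move=> mw w0; pose nu A := (\int[mu]_(x in A) w x)%E.
have nu0 : nu set0 = 0%E by rewrite /nu integral_set0.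
have nu_ge0 A : (0 <= nu A)%E by apply: integral_ge0.
have nu_sigma_additive : semi_sigma_additive nu.
  move=> F mF tF mUF; rewrite /nu ge0_integral_bigcup//=.
    by apply: is_cvg_ereal_nneg_natsum_cond => n _ _; exact: nu_ge0.
  exact: measurable_funTS.
pose M := isMeasure.Build _ _ _ nu nu0 nu_ge0 nu_sigma_additive.
by exists (HB.pack nu M : {measure set X -> \bar R}).
Qed.

Section transfer_density.
Local Open Scope ereal_scope.
Context (d : measure_display) (X : measurableType d) (R : realType).
Variable m : {sigma_finite_measure set X -> \bar R}.

(** The Radon-Nikodym derivative of [nu] and the function [a] have the same integral over every
    measurable set, so they agree almost everywhere, and the change of variables known for the
    derivative passes to [a]. *)
Lemma integral_density (nu : {finite_measure set X -> \bar R})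
    (a f : X -> \bar R) (A : set X) :
  m.-integrable setT a -> (forall x, 0 <= a x) ->
  (forall B, measurable B -> nu B = \int[m]_(x in B) a x) ->
  measurable A -> measurable_fun A f -> (forall x, 0 <= f x) ->
  \int[nu]_(x in A) f x = \int[m]_(x in A) (f x * a x).
Proof.
move=> ia a0 nuE mA mf f0.
have ma := measurable_int _ ia.
have num : nu `<< m.
  apply/null_content_dominatesP => B mB mB0; rewrite nuE//.
  by rewrite null_set_integral//; exact: measurable_funTS.
have iRN := Radon_Nikodym_SigmaFinite.f_integrable num.
rewrite -(Radon_Nikodym_SigmaFinite.change_of_variables num)//.
apply: ge0_ae_eq_integral => //.
- by apply: emeasurable_funM => //; exact: measurable_funTS (measurable_int _ iRN).
- by apply: emeasurable_funM => //; exact: measurable_funTS.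
- by move=> x _; rewrite mule_ge0// Radon_Nikodym_SigmaFinite.f_ge0.
- by move=> x _; rewrite mule_ge0.
- apply: ae_eqe_mul2l; apply: (@ae_eq_subset _ _ _ _ _ setT) => //.
  apply: integral_ae_eq => //.
  by move=> E _ mE; rewrite -nuE// -Radon_Nikodym_SigmaFinite.f_integral.
Qed.

(** [h] is the transfer operator of [S] applied to [a]: the Radon-Nikodym density of the image under
    [S] of the measure with density [a]. This image is absolutely continuous because [S] pulls null
    sets back to null sets. *)
Lemma transfer_density_exists (S : X -> X) (a : X -> \bar R) :
  measurable_fun setT S ->
  (forall A, measurable A -> m A = 0 -> m (S @^-1` A) = 0) ->
  m.-integrable setT a -> (forall x, 0 <= a x) ->
  exists h : X -> R, [/\ measurable_fun setT h, (forall x, 0 <= h x)%R &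
    forall (A : set X) (f : X -> \bar R), measurable A ->
      measurable_fun setT f -> (forall x, 0 <= f x) ->
      \int[m]_(x in S @^-1` A) (f (S x) * a x) =
      \int[m]_(x in A) (f x * (h x)%:E)].
Proof.
move=> mS m_nonsing ia a0.
have ma : measurable_fun setT a by exact: measurable_int ia.
have mSA A : measurable A -> measurable (S @^-1` A).
  by move=> mA; rewrite -(setTI (_ @^-1` _)); exact: mS.
have [nu0 nu0E] := density_measure_exists m ma a0.
have nu0T : nu0 setT < +oo.
  have /integrableP[_] := ia; rewrite nu0E; apply: le_lt_trans.
  by rewrite le_eqVlt; apply/orP; left; apply/eqP;
    apply: eq_integral => x _; rewrite gee0_abs.
(* Restricting to the whole space changes no value; it records that the measure is finite. *)
pose nu : {finite_measure set X -> \bar R} := mfrestr measurableT nu0T.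
have nuE A : nu A = nu0 A by rewrite /nu /= /mfrestr /mrestr setIT.
unshelve epose (la0 := (pushforward nu S : {measure set X -> \bar R})).
  exact: mS.
have la0T : la0 setT < +oo by rewrite /la0 /= /pushforward nuE.
pose la : {finite_measure set X -> \bar R} := mfrestr measurableT la0T.
have laE A : la A = la0 A by rewrite /la /= /mfrestr /mrestr setIT.
have lam : la `<< m.
  apply/null_content_dominatesP => B mB mB0.
  rewrite laE /la0 /= /pushforward nuE nu0E.
  rewrite null_set_integral//; [exact: mSA|exact: measurable_funTS|].
  exact: m_nonsing.
pose h := Radon_Nikodym_SigmaFinite.f la m.
have hE : EFin \o (fine \o h) = h.
  by apply/funext => x /=; rewrite fineK// Radon_Nikodym_SigmaFinite.f_fin_num.
exists (fine \o h); split.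
- apply/measurable_EFinP; rewrite hE.
  exact: measurable_int (Radon_Nikodym_SigmaFinite.f_integrable lam).
- by move=> x /=; rewrite fine_ge0// Radon_Nikodym_SigmaFinite.f_ge0.
- move=> A f mA mf f0.
  transitivity (\int[la]_(x in A) f x); last first.
    rewrite -(Radon_Nikodym_SigmaFinite.change_of_variables lam)//; last first.
      exact: measurable_funTS.
    by apply: eq_integral => x _; rewrite -[in LHS]/(h x) -[in LHS]hE.
  transitivity (\int[nu]_(x in S @^-1` A) (f \o S) x).
    apply/esym/integral_density => //.
    + by move=> B mB; rewrite nuE nu0E.
    + exact: mSA.
    + by apply: measurable_funTS; exact: measurableT_comp.
    + by move=> x; exact: f0.
  rewrite -ge0_integral_pushforward//; last exact: measurable_funTS.
  by apply/esym/(eq_measure_integral la0) => B _ _; exact: laE.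
Qed.

End transfer_density.

(** One round of the filling scheme. The mass [a], carried by [S], arrives with density [h] and
    meets the demand [v]; the amount [min(v, h)] is absorbed and [w] is the demand left over.
    Pulling the absorbed fraction back along [S] gives [rho], the absorbed mass seen from its
    starting point. Demand remains only where everything that arrived was absorbed. *)
Lemma absorption_step (d : measure_display) (X : measurableType d)
    (R : realType) (m : {sigma_finite_measure set X -> \bar R}) (S : X -> X)
    (a v : X -> R) :
  measurable_fun setT S ->
  (forall A, measurable A -> m A = 0%E -> m (S @^-1` A) = 0%E) ->
  m.-integrable setT (EFin \o a) -> (forall x, 0 <= a x) ->
  measurable_fun setT v -> (forall x, 0 <= v x) ->
  exists rho w : X -> R,
    [/\ measurable_fun setT rho, measurable_fun setT w,
        forall x, 0 <= rho x <= a x, forall x, 0 <= w x <= v x &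
        forall x, 0 < w (S x) -> rho x = a x] /\
    forall A, measurable A ->
      (\int[m]_(x in S @^-1` A) (rho x)%:E =
       \int[m]_(x in A) (v x - w x)%:E)%E.
Proof.
move=> mS m_nonsing ia a0 mv v0.
have [|h [mh h0 hE]] := transfer_density_exists mS m_nonsing ia.
  by move=> x /=; rewrite lee_fin.
have ma : measurable_fun setT a by exact/measurable_EFinP/(measurable_int _ ia).
(* [q] is the absorbed fraction [min(v, h) / h]. In the first branch [0 <= v x < h x], so the
   division is legitimate; the value 1 elsewhere means full absorption and covers [h x = 0]. The
   inverse is a power so that [measurable_powR] applies. *)
pose q x := if v x < h x then v x * h x `^ (-1) else 1.
have qE x : q x * h x = Num.min (v x) (h x).
  rewrite /q; case: (ltP (v x) (h x)) => [vh|//]; last by rewrite mul1r.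
  have hx : 0 < h x by rewrite (le_lt_trans (v0 x)).
  by rewrite powR_inv1 ?ltW// divfK// gt_eqF.
have q0 x : 0 <= q x by rewrite /q; case: ifP => // _; rewrite mulr_ge0// powR_ge0.
have q1 x : q x <= 1.
  rewrite /q; case: (ltP (v x) (h x)) => [vh|//].
  have hx : 0 < h x by rewrite (le_lt_trans (v0 x)).
  by rewrite powR_inv1 ?(ltW hx)// ler_pdivrMr// mul1r ltW.
have mq : measurable_fun setT q.
  apply: measurable_fun_ifT => //; first exact: measurable_fun_ltr.
  apply: measurable_funM => //.
  exact: (measurableT_comp (measurable_powR _)).
exists (fun x => q (S x) * a x), (fun x => Num.max 0 (v x - h x)).
have wE x : v x - Num.max 0 (v x - h x) = Num.min (v x) (h x).
  case: (ltP (v x) (h x)) => vh; first by rewrite max_l ?subr0// subr_le0 ltW.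
  by rewrite max_r ?subr_ge0// opprB addrC subrK.
split; first split.
- by apply: measurable_funM => //; exact: measurableT_comp.
- by apply: measurable_maxr => //; exact: measurable_funB.
- by move=> x; rewrite mulr_ge0//= ler_piMl.
- move=> x; rewrite le_max lexx/= ge_max v0/= lerBlDr lerDl//.
- move=> x; rewrite lt_max ltxx/= subr_gt0 => hv.
  by rewrite /q ltNge ltW//= mul1r.
- move=> A mA; under eq_integral do rewrite EFinM.
  have mEq : measurable_fun setT (EFin \o q) by exact/measurable_EFinP.
  have Eq0 x : (0 <= (EFin \o q) x)%E by rewrite /= lee_fin.
  rewrite (hE A (EFin \o q) mA mEq Eq0).
  by apply: eq_integral => x _; rewrite -EFinM qE wE.
Qed.

(** * Recurrence under measure-preserving and ergodic maps *)

Section measure_preserving_map.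
Context (d : measure_display) (X : measurableType d) (R : realType).
Variables (m : probability X R) (T : {mfun X >-> X}).

Lemma measurable_iter (k : nat) : measurable_fun setT (iter k T).
Proof.
elim: k => [|k IH]; first exact: measurable_id.
exact: measurableT_comp (@measurable_funPT _ _ _ _ T) IH.
Qed.

Lemma measurable_preimage_iter (k : nat) (A : set X) :
  measurable A -> measurable (iter k T @^-1` A).
Proof.
by move=> mA; rewrite -(setTI (_ @^-1` _)); exact: measurable_iter.
Qed.

Hypothesis T_preserving : measure_preserving m T.

Lemma measure_preimage_iter (k : nat) (A : set X) :
  measurable A -> m (iter k T @^-1` A) = m A.
Proof.
move=> mA; elim: k => [//|k IH].
rewrite -[RHS]IH -[RHS]T_preserving; last exact: measurable_preimage_iter.
by congr (m _); apply/seteqP; split => x /=; rewrite -iterSr -iterS.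
Qed.

Lemma ae_iter (P : X -> Prop) :
  {ae m, forall x, P x} -> {ae m, forall x, forall k, P (iter k T x)}.
Proof.
move=> aeP; apply/ae_foralln => k; have [N [mN N0 PN]] := aeP.
exists (iter k T @^-1` N); split.
- exact: measurable_preimage_iter.
- exact: etrans (measure_preimage_iter k mN) N0.
- by move=> x /= nPx; exact: PN.
Qed.

(** The limsup is the decreasing intersection of the tail unions. Each of these contains some [A k]
    of measure at least [c], and continuity from above keeps the bound. *)
Lemma measure_lim_sup_set_ge (A : (set X)^nat) (c : \bar R) :
  (forall k, measurable (A k)) ->
  (forall n, exists2 k, (n <= k)%N & (c <= m (A k))%E) ->
  (c <= m (lim_sup_set A))%E.
Proof.
move=> mA hA.
have mU n : measurable (\bigcup_(k in [set k | (n <= k)%N]) A k).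
  exact: bigcup_measurable.
have lim_sup_cvg : m (\bigcup_(k >= n) A k) @[n --> \oo] --> m (lim_sup_set A).
  by apply: lim_sup_set_cvg => //; rewrite (le_lt_trans (probability_le1 _ _))// ltry.
rewrite -(cvg_lim _ lim_sup_cvg)//; apply: lime_ge.
  by apply/cvg_ex; exists (m (lim_sup_set A)).
apply: nearW => n; have [k nk] := hA n; move/le_trans; apply.
by apply: le_measure; rewrite ?inE//; exact: bigcup_sup.
Qed.

Hypothesis T_ergodic : ergodic m T.

(** The union of the preimages of [B] need not equal its own preimage, whereas the set [L] of points
    visiting [B] infinitely often does. Since [L] has measure at least [m B > 0], ergodicity gives
    it measure 1, and it lies inside the union. *)
Lemma ergodic_visit (B : set X) : measurable B -> m B != 0%E ->
  m (\bigcup_k (iter k T @^-1` B)) = 1%E.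
Proof.
move=> mB mB0; pose A k := iter k T @^-1` B.
have mA k : measurable (A k) by exact: measurable_preimage_iter.
pose L := lim_sup_set A.
have mL : measurable L.
  by apply: bigcap_measurable => // n _; exact: bigcup_measurable.
have LB : (m B <= m L)%E.
  apply: measure_lim_sup_set_ge => // n; exists n => //.
  by rewrite measure_preimage_iter.
have TL : T @^-1` L = L.
  apply/seteqP; split => x Lx n _.
  - have [k /= nk] := Lx n I; rewrite /A /= -iterSr => Bk.
    by exists k.+1 => //=; rewrite ltnW.
  - have [[//|k] /= nk] := Lx n.+1 I; rewrite /A /= -iterS iterSr => Bk.
    by exists k.
have mLE : m L = 1%E.
  have [L0|//] := T_ergodic mL TL.
  by move: LB mB0; rewrite L0 measure_le0 => ->.
apply/eqP; rewrite eq_le probability_le1; last exact: bigcupT_measurable.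
rewrite /= -mLE; apply: le_measure; rewrite ?inE//.
- exact: bigcupT_measurable.
- by move=> x /(_ 0%N I)[k _ Bk]; exists k.
Qed.

End measure_preserving_map.

(** * The filling scheme *)

Lemma le_integral_eq_ae_eq (d : measure_display) (X : measurableType d)
    (R : realType) (mu : {measure set X -> \bar R}) (u : X -> \bar R)
    (w : X -> R) :
  measurable_fun setT u -> mu.-integrable setT (EFin \o w) ->
  (forall x, 0 <= u x <= (w x)%:E)%E ->
  (\int[mu]_x u x = \int[mu]_x (w x)%:E)%E ->
  {ae mu, forall x, u x = (w x)%:E}.
Proof.
move=> mu_ iw uw E.
have mw := measurable_int _ iw.
have u0 x : (0 <= u x)%E by have /andP[] := uw x.
have ux_fin x : u x \is a fin_num.
  have /andP[_ /le_lt_trans ux] := uw x.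
  by rewrite ge0_fin_numE//; apply: ux; rewrite ltry.
have iu : mu.-integrable setT u.
  apply: le_integrable iw => // x _; have /andP[? ux] := uw x.
  by rewrite gee0_abs// (le_trans ux)// lee_abs.
have : ae_eq mu setT ((EFin \o w) \- u)%E (cst 0%E).
  apply/ae_eq_integral_abs => //; first exact: emeasurable_funB.
  under eq_integral => x _.
    rewrite gee0_abs; last first.
      by rewrite /= sube_ge0 ?ux_fin// ; have /andP[] := uw x.
    over.
  rewrite integralB// E subee//.
  exact: integrable_fin_num.
apply: filterS => x /(_ I) /= /eqP.
by rewrite sube_eq ?add0e ?fin_num_adde_defl// => /eqP.
Qed.

(** Applied to remaining mass and remaining demand: the total settled never exceeds the initial
    amount, and reaches it as soon as some [u n] vanishes. *)
Lemma telescope_nneseries_bounds (R : realType) (u : nat -> R) (n : nat) :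
  (forall k, u k.+1 <= u k) -> (forall k, 0 <= u k) ->
  ((u 0%N - u n)%:E <= \sum_(0 <= k <oo) (u k - u k.+1)%:E <= (u 0%N)%:E)%E.
Proof.
move=> u_ni u0.
have telE j : (\sum_(0 <= k < j) (u k - u k.+1)%:E = (u 0%N - u j)%:E)%E.
  elim: j => [|j IH]; first by rewrite big_geq// subrr.
  by rewrite big_nat_recr//= IH -EFinD addrA subrK.
have du0 k : (0 <= (u k - u k.+1)%:E)%E by rewrite lee_fin subr_ge0.
apply/andP; split; first by rewrite -telE; exact: nneseries_lim_ge.
apply: lime_le; first exact: is_cvg_nneseries.
by apply: nearW => j; rewrite telE lee_fin lerBlDr lerDl.
Qed.

Section filling_scheme.
Context (d : measure_display) (X : measurableType d) (R : realType).
Variables (m : probability X R) (T : {mfun X >-> X}).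
Hypothesis T_preserving : measure_preserving m T.

(** Iterates [absorption_step] with [S] equal to [iter k T] at round [k]. [a k] is the mass still
    unsettled before round [k], indexed by its starting point rather than its current position;
    [v k] is the demand still open. Round 0 uses the identity, so mass may settle where it
    starts. *)
Lemma filling_sequence (g : X -> R) :
  measurable_fun setT g -> (forall x, 0 <= g x) ->
  exists a v : nat -> X -> R,
    [/\ a 0%N = cst 1, v 0%N = g,
        forall k, measurable_fun setT (a k) /\ measurable_fun setT (v k),
        forall k x, 0 <= a k.+1 x <= a k x /\ 0 <= v k.+1 x <= v k x &
        forall k x, 0 < v k.+1 (iter k T x) -> a k.+1 x = 0] /\
    forall k (A : set X), measurable A ->
      (\int[m]_(x in iter k T @^-1` A) (a k x - a k.+1 x)%:E =
       \int[m]_(x in A) (v k x - v k.+1 x)%:E)%E.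
Proof.
move=> mg g0.
(* The invariant of the recursion: the bound of the mass by 1 keeps it integrable, so that another
   round is always possible. *)
pose good (s : (X -> R) * (X -> R)) :=
  (measurable_fun setT s.1 /\ forall x, 0 <= s.1 x <= 1) /\
  (measurable_fun setT s.2 /\ forall x, 0 <= s.2 x).
pose next k (s s' : (X -> R) * (X -> R)) :=
  [/\ forall x, s'.1 x <= s.1 x, forall x, s'.2 x <= s.2 x,
      forall x, 0 < s'.2 (iter k T x) -> s'.1 x = 0 &
      forall A, measurable A ->
      (\int[m]_(x in iter k T @^-1` A) (s.1 x - s'.1 x)%:E =
       \int[m]_(x in A) (s.2 x - s'.2 x)%:E)%E].
have step (ks : nat * {s | good s}) :
    exists s' : {s | good s}, next ks.1 (sval ks.2) (sval s').
  case: ks => k [[a v] [/= [ma a01] [mv v0]]].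
  have a0 x : 0 <= a x by have /andP[] := a01 x.
  have ia : m.-integrable setT (EFin \o a).
    apply: (le_integrable measurableT (g := cst 1%E)).
    - exact/measurable_EFinP.
    - move=> x _; rewrite /= normr1 lee_fin ger0_norm//.
      by have /andP[] := a01 x.
    - exact: finite_measure_integrable_cst.
  have nonsing A : measurable A -> m A = 0%E -> m (iter k T @^-1` A) = 0%E.
    by move=> mA mA0; rewrite measure_preimage_iter.
  have [rho [w [[mrho mw rhoa wv rhoE] intE]]] :=
    absorption_step (measurable_iter T k) nonsing ia a0 mv v0.
  have gs' : good (fun x => a x - rho x, w).
    split; split => //=; first exact: measurable_funB.
    - move=> x; have /andP[rho0 rhoax] := rhoa x; have /andP[_ a1] := a01 x.
      by rewrite subr_ge0 rhoax/= lerBlDr (le_trans a1)// lerDl.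
    - by move=> x; have /andP[] := wv x.
  exists (exist _ _ gs'); split => /= [x|x|x|A mA].
  - by have /andP[rho0 _] := rhoa x; rewrite lerBlDr lerDl.
  - by have /andP[] := wv x.
  - by move=> /rhoE ->; rewrite subrr.
  - by rewrite -intE//; apply: eq_integral => x _; rewrite subKr.
have [F HF] := choice step.
have good0 : good (cst 1, g) by do 2!split => //=; move=> x; rewrite ler01 lexx.
pose s := fix s k := if k is j.+1 then F (j, s j) else exist _ _ good0.
have snext k : next k (sval (s k)) (sval (s k.+1)) by exact: HF (k, s k).
exists (fun k => (sval (s k)).1), (fun k => (sval (s k)).2); split; first split.
- by [].
- by [].
- by move=> k; have [[? _] [? _]] := svalP (s k).
- move=> k x; have [ale vle _ _] := snext k.
  have [[_ a01] [_ v0]] := svalP (s k.+1).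
  by have /andP[a0 _] := a01 x; rewrite a0 v0 ale vle.
- by move=> k x; have [_ _ + _] := snext k; exact.
- by move=> k A mA; have [_ _ _] := snext k; exact.
Qed.

Hypothesis T_ergodic : ergodic m T.

(* A particle starting at x survives step k only if T^k x lies outside the set
   B where the demand is never met; by ergodicity almost every orbit visits B
   unless B is null. *)
Lemma filling_scheme (g : X -> R) :
  m.-integrable setT (EFin \o g) -> (forall x, 0 <= g x) ->
  (\int[m]_x (g x)%:E = 1)%E ->
  exists rho : nat -> X -> R,
    [/\ forall k, measurable_fun setT (rho k), forall k x, 0 <= rho k x,
        {ae m, forall x, (\sum_(0 <= k <oo) (rho k x)%:E = 1)%E} &
        forall A, measurable A ->
          (\sum_(0 <= k <oo) \int[m]_(x in iter k T @^-1` A) (rho k x)%:E =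
           \int[m]_(x in A) (g x)%:E)%E].
Proof.
move=> ig g0 g1.
have mg : measurable_fun setT g by exact/measurable_EFinP/(measurable_int _ ig).
have [a [v [[aE vE mav av_ni aB] intE]]] := filling_sequence mg g0.
have a_ni k x : a k.+1 x <= a k x by have [/andP[]] := av_ni k x.
have v_ni k x : v k.+1 x <= v k x by have [_ /andP[]] := av_ni k x.
have a0 k x : 0 <= a k x.
  by case: k => [|k]; [rewrite aE|have [/andP[]] := av_ni k x].
have v0 k x : 0 <= v k x.
  by case: k => [|k]; [rewrite vE|have [_ /andP[]] := av_ni k x].
(* [rho k] is the mass settled at round [k], seen from its start; [gam k] is the same mass seen from
   where it settles. *)
pose rho k x := a k x - a k.+1 x.
pose gam k x := v k x - v k.+1 x.
have rho0 k x : (0 <= (rho k x)%:E)%E by rewrite lee_fin subr_ge0.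
have gam0 k x : (0 <= (gam k x)%:E)%E by rewrite lee_fin subr_ge0.
have mrho k : measurable_fun setT (rho k).
  by apply: measurable_funB; have [] := mav k; have [] := mav k.+1.
have mgam k : measurable_fun setT (gam k).
  by apply: measurable_funB; have [] := mav k; have [] := mav k.+1.
pose srho x := (\sum_(0 <= k <oo) (rho k x)%:E)%E.
pose sgam x := (\sum_(0 <= k <oo) (gam k x)%:E)%E.
have msrho : measurable_fun setT srho.
  by apply: ge0_emeasurable_sum => // k _; exact/measurable_EFinP.
have msgam : measurable_fun setT sgam.
  by apply: ge0_emeasurable_sum => // k _; exact/measurable_EFinP.
have srho_bounds n x : ((1 - a n x)%:E <= srho x <= 1)%E.
  have := @telescope_nneseries_bounds R (a ^~ x) n (a_ni ^~ x) (a0 ^~ x).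
  by rewrite aE.
have sgam_bounds n x : ((g x - v n x)%:E <= sgam x <= (g x)%:E)%E.
  have := @telescope_nneseries_bounds R (v ^~ x) n (v_ni ^~ x) (v0 ^~ x).
  by rewrite vE.
(* Total settled mass equals total filled demand: the balance [intE] on the whole space, summed over
   the rounds. *)
have int_srho : (\int[m]_x srho x = \int[m]_x sgam x)%E.
  rewrite integral_nneseries//; last by move=> k; exact/measurable_EFinP.
  rewrite integral_nneseries//; last by move=> k; exact/measurable_EFinP.
  by apply: eq_eseriesr => k _; rewrite -intE.
have i1 : m.-integrable setT (EFin \o cst 1).
  exact: finite_measure_integrable_cst.
have int1 : (\int[m]_x (cst 1%R x : R)%:E = 1)%E.
  rewrite -[RHS](@probability_setT _ _ _ m) -[RHS]mul1e.
  exact: (integral_cst m measurableT 1%E).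
have srho_ae : (\int[m]_x srho x = 1)%E -> {ae m, forall x, srho x = 1%E}.
  move=> E; apply: (@le_integral_eq_ae_eq _ _ _ _ _ (cst 1)) => //.
    move=> x; have /andP[_ ->] := srho_bounds 0%N x.
    by rewrite andbT; exact: nneseries_ge0.
  by rewrite E int1.
have sgam_ae : (\int[m]_x sgam x = 1)%E -> {ae m, forall x, sgam x = (g x)%:E}.
  move=> E; apply: le_integral_eq_ae_eq => //.
    move=> x; have /andP[_ ->] := sgam_bounds 0%N x.
    by rewrite andbT; exact: nneseries_ge0.
  by rewrite E g1.
pose B := [set x | (sgam x < (g x)%:E)%E].
have mB : measurable B.
  rewrite -(setTI B); apply: measurable_lte => //.
  exact: measurable_int ig.
(* Demand that is never met at [iter k T x] is still open after round [k], so by [aB] nothing that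
   started at [x] is left. *)
have srhoB k x : B (iter k T x) -> srho x = 1%E.
  move=> Bx.
  have vk : 0 < v k.+1 (iter k T x).
    rewrite lt_neqAle v0 andbT; apply: contraTneq Bx => vk0.
    have /andP[+ _] := sgam_bounds k.+1 (iter k T x).
    by rewrite -vk0 subr0 /B /= leNgt.
  have /andP[+ le1] := srho_bounds k.+1 x.
  by rewrite (aB _ _ vk) subr0 => ge1; apply/eqP; rewrite eq_le le1.
have [srho1 sgam1] : {ae m, forall x, srho x = 1%E} /\
    {ae m, forall x, sgam x = (g x)%:E}.
  have [B0|B0] := eqVneq (m B) 0%E.
    have sgam1 : {ae m, forall x, sgam x = (g x)%:E}.
      exists B; split => // x /= sg; rewrite /B /= lt_neqAle.
      have /andP[_ ->] := sgam_bounds 0%N x.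
      by rewrite andbT; exact/eqP.
    split=> //; apply: srho_ae; rewrite int_srho -g1.
    apply: ge0_ae_eq_integral => //.
    - exact: measurable_int ig.
    - by move=> x _; exact: nneseries_ge0.
    - by move=> x _; rewrite lee_fin.
    - by apply: filterS sgam1 => x ? _.
  have mU : measurable (\bigcup_k (iter k T @^-1` B)).
    by apply: bigcupT_measurable => k; exact: measurable_preimage_iter.
  have srho1 : {ae m, forall x, srho x = 1%E}.
    exists (~` (\bigcup_k (iter k T @^-1` B))); split.
    - exact: measurableC.
    - by rewrite probability_setC// ergodic_visit// subee.
    - by move=> x /= sx [k _ Bk]; apply: sx; exact: srhoB Bk.
  split => //; apply: sgam_ae; rewrite -int_srho -int1.
  apply: ge0_ae_eq_integral => //.
  - exact: measurable_int i1.
  - by move=> x _; exact: nneseries_ge0.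
  - by apply: filterS srho1 => x ? _.
exists rho; split => // A mA.
transitivity (\int[m]_(x in A) sgam x)%E.
  rewrite integral_nneseries//; last first.
    by move=> k; apply: measurable_funTS; exact/measurable_EFinP.
  by apply: eq_eseriesr => k _; rewrite -intE.
apply: ge0_ae_eq_integral => //.
- exact: measurable_funTS.
- exact/measurable_funTS/(measurable_int _ ig).
- by move=> x _; exact: nneseries_ge0.
- by move=> x _; rewrite lee_fin.
- by apply: filterS sgam1 => x ? _.
Qed.

End filling_scheme.

(** * Moving a coupling by a randomized time *)

Section shift_coupling.
Context (d dW : measure_display) (X : measurableType d)
  (Omega : measurableType dW) (R : realType).
Variables (m : probability X R) (PW : probability Omega R).
Variables (P : probability (X * Omega)%type R).
Hypothesis P_coupling : coupling m PW P.

Lemma ae_coupling_fst (Q : X -> Prop) :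
  {ae m, forall x, Q x} -> {ae P, forall z, Q z.1}.
Proof.
move=> [N [mN N0 QN]]; exists (fst @^-1` N); split.
- by rewrite -(setTI (_ @^-1` _)); exact: measurable_fst.
- by have [/(_ N mN) + _] := P_coupling; rewrite /pushforward => ->.
- by move=> z /= nQ; exact: QN.
Qed.

Lemma integral_coupling_fst (f : X -> \bar R) (A : set X) :
  measurable A -> measurable_fun setT f -> (forall x, 0 <= f x)%E ->
  (\int[P]_(z in fst @^-1` A) f z.1 = \int[m]_(x in A) f x)%E.
Proof.
move=> mA mf f0.
rewrite -[LHS](ge0_integral_pushforward measurable_fst P mA) //; last first.
  exact: measurable_funTS.
unshelve epose (mu := (pushforward P fst : {measure set X -> \bar R})).
  exact: measurable_fst.
apply: (@eq_measure_integral _ _ _ _ m mu) => B mB _.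
by have [/(_ B mB)] := P_coupling.
Qed.

Definition iter_fst (T : X -> X) (k : nat) (z : X * Omega) : X * Omega :=
  (iter k T z.1, z.2).

Lemma measurable_iter_fst (T : {mfun X >-> X}) (k : nat) :
  measurable_fun setT (iter_fst T k).
Proof.
apply: measurable_fun_pair; last exact: measurable_snd.
exact: measurableT_comp (measurable_iter T k) measurable_fst.
Qed.

(** [rho k x] is the probability of stopping at time [k] when starting from [x]. [P'] sums over [k]
    the images under [iter_fst T k] of the measures with density [rho k] with respect to [P]. The
    last clause transfers almost sure statements from [P] to [P']. *)
Lemma shift_coupling_exists (T : {mfun X >-> X}) (m' : probability X R)
    (rho : nat -> X -> R) :
  (forall k, measurable_fun setT (rho k)) -> (forall k x, 0 <= rho k x) ->
  {ae m, forall x, (\sum_(0 <= k <oo) (rho k x)%:E = 1)%E} ->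
  (forall A, measurable A ->
    (\sum_(0 <= k <oo) \int[m]_(x in iter k T @^-1` A) (rho k x)%:E =
     m' A)%E) ->
  exists P' : probability (X * Omega)%type R, coupling m' PW P' /\
    forall A, measurable A -> (forall k, P (iter_fst T k @^-1` A) = 0%E) ->
      P' A = 0%E.
Proof.
move=> mrho rho0 rho1 rhoE.
have mrhoE k : measurable_fun setT (EFin \o rho k) by exact/measurable_EFinP.
have mw k : measurable_fun setT (fun z : X * Omega => (rho k z.1)%:E).
  exact: measurableT_comp (mrhoE k) measurable_fst.
have w0 k (z : X * Omega) : (0 <= (rho k z.1)%:E)%E by rewrite lee_fin.
have [nu nuE] := choice (fun k => density_measure_exists P (mw k) (w0 k)).
have [M ME] : exists M : nat -> {measure set (X * Omega)%type -> \bar R},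
    forall k A, M k A = nu k (iter_fst T k @^-1` A).
  unshelve eexists (fun k => (pushforward (nu k) (iter_fst T k)
    : {measure set (X * Omega)%type -> \bar R})).
  - exact: measurable_iter_fst.
  - by [].
pose mu : {measure set (X * Omega)%type -> \bar R} := mseries M 0.
have muE A : mu A = (\sum_(0 <= k <oo)
    \int[P]_(z in iter_fst T k @^-1` A) (rho k z.1)%:E)%E.
  by apply: eq_eseriesr => k _; rewrite ME nuE.
have mu_fst A : measurable A -> mu (fst @^-1` A) = m' A.
  move=> mA; rewrite muE -rhoE//; apply: eq_eseriesr => k _.
  rewrite -(integral_coupling_fst (f := EFin \o rho k))//.
    exact: measurable_preimage_iter.
  by move=> x; rewrite /= lee_fin.
(* The shift leaves the second coordinate alone, so the sum over [k] can enter the integral, where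
   the weights add up to 1 almost surely. *)
have mu_snd B : measurable B -> mu (snd @^-1` B) = PW B.
  move=> mB; have msB : measurable (@snd X Omega @^-1` B).
    by rewrite -(setTI (_ @^-1` _)); exact: measurable_snd.
  transitivity (\int[P]_(z in snd @^-1` B) (cst 1%E z))%E; last first.
    rewrite integral_cst// mul1e.
    by have [_ /(_ B mB)] := P_coupling.
  transitivity (\sum_(0 <= k <oo)
      \int[P]_(z in snd @^-1` B) (rho k z.1)%:E)%E; first exact: muE.
  rewrite -integral_nneseries//; last first.
    by move=> k; exact: measurable_funTS.
  apply: ge0_ae_eq_integral => //.
  - by apply: measurable_funTS; apply: ge0_emeasurable_sum.
  - by move=> z _; exact: nneseries_ge0.
  - by apply: filterS (ae_coupling_fst rho1) => z ? _.
have muT : mu setT = 1%E.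
  by rewrite -[RHS](@probability_setT _ _ _ m') -mu_fst.
(* [mu] already has mass 1, so normalizing only makes it a probability; [P] is the fallback for a
   degenerate mass. *)
pose P' := mnormalize mu P.
have P'E A : P' A = mu A.
  by rewrite /P' /= /mnormalize muT /= onee_eq0 /= invr1 mule1.
exists P'; split.
  split=> A mA; first exact: etrans (P'E _) (mu_fst A mA).
  exact: etrans (P'E _) (mu_snd A mA).
move=> A mA A0; apply: (etrans (P'E A)); rewrite muE.
apply: eseries0 => k _ _.
apply: null_set_integral => //; last exact: A0.
  by rewrite -(setTI (_ @^-1` _)); exact: measurable_iter_fst.
exact: measurable_funTS.
Qed.

End shift_coupling.

(** * Little-o for real sequences *)

Section littleo_sequences.
Context (R : realType).
Implicit Types u v r : nat -> R.

Lemma eqo_seqP u r : u =o_\oo r <->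
  forall e : R, 0 < e -> \forall n \near \oo, `|u n| <= e * `|r n|.
Proof. by split => [/eqoP//|?]; apply/eqoP. Qed.

Lemma eqo_seqD u v r : u =o_\oo r -> v =o_\oo r ->
  (fun n => u n + v n) =o_\oo r.
Proof.
move=> /eqo_seqP ur /eqo_seqP vr; apply/eqo_seqP => e e0.
have e20 : 0 < e / 2 by rewrite divr_gt0.
near=> n; rewrite (splitr e) mulrDl (le_trans (ler_normD _ _))// lerD//.
- by near: n; exact: ur.
- by near: n; exact: vr.
Unshelve. all: by end_near. Qed.

Lemma eqo_seqN u r : u =o_\oo r -> (fun n => - u n) =o_\oo r.
Proof.
move=> /eqo_seqP ur; apply/eqo_seqP => e /ur.
by apply: filterS => n; rewrite normrN.
Qed.

Lemma eqo_seq_norm u r : (fun n => `|u n|) =o_\oo r <-> u =o_\oo r.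
Proof.
split=> /eqo_seqP ur; apply/eqo_seqP => e /ur;
  by apply: filterS => n; rewrite normr_id.
Qed.

(** Restricting the tolerance to inverses of positive integers turns little-o into a countable
    combination of inequalities. This is needed because [shift_coupling_exists] transfers null sets
    only when they are measurable. *)
Lemma measurable_eqo_seq (d : measure_display) (Z : measurableType d)
    (u : nat -> Z -> R) r : (forall n, measurable_fun setT (u n)) ->
  measurable [set z | (fun n => u n z) =o_\oo r].
Proof.
move=> mu.
rewrite (_ : mkset _ = \bigcap_j \bigcup_N \bigcap_(n in [set n | (N <= n)%N])
    [set z | `|u n z| <= j.+1%:R^-1 * `|r n|]); last first.
  apply/seteqP; split => z.
  - move=> /eqo_seqP zr j _; have j0 : 0 < j.+1%:R^-1 :> R by [].
    by have [N _ HN] := zr _ j0; exists N => // n /= Nn; exact: HN.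
  - move=> zr; apply/eqo_seqP => e e0.
    have [N _ HN] := zr (Num.truncn e^-1) I; exists N => // n /= Nn.
    apply: (le_trans (HN n Nn)); rewrite ler_wpM2r//.
    by rewrite invf_ple ?posrE// ltW// truncnS_gt.
apply: bigcapT_measurable => j; apply: bigcupT_measurable => N.
apply: bigcap_measurable => [|n _]; first by exists N => /=.
rewrite -(setTI (mkset _)); apply: measurable_fun_le => //.
exact: measurableT_comp.
Qed.

End littleo_sequences.

(** * Birkhoff sums along an orbit *)

Lemma birkhoff_sum_shift (X : Type) (R : realType) (T : X -> X) (f : X -> R)
    (n : nat) (x : X) :
  birkhoff_sum T f n (T x) - birkhoff_sum T f n x = f (iter n T x) - f x.
Proof.
have E : birkhoff_sum T f n (T x) = \sum_(0 <= k < n) f (iter k.+1 T x).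
  by apply: eq_bigr => k _; rewrite iterSr.
rewrite E /birkhoff_sum -sumrB; elim: n {E} => [|n IH].
  by rewrite big_geq// subrr.
by rewrite big_nat_recr//= IH addrC subrKA.
Qed.

Lemma birkhoff_sum_iter_eqo (X : Type) (R : realType) (T : X -> X) (f : X -> R)
    (r : nat -> R) (x : X) :
  (forall k, (fun n => f (iter n T (iter k T x))) =o_\oo r) ->
  (forall k, (fun=> f (iter k T x)) =o_\oo r) ->
  forall k, (fun n => birkhoff_sum T f n (iter k T x) - birkhoff_sum T f n x)
    =o_\oo r.
Proof.
move=> fn_small f_small; elim=> [|k IH].
  apply/eqo_seqP => e e0; apply: nearW => n /=.
  by rewrite subrr normr0 mulr_ge0// ltW.
rewrite (_ : (fun n => _) = fun n =>
    (f (iter n T (iter k T x)) + - f (iter k T x)) +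
    (birkhoff_sum T f n (iter k T x) - birkhoff_sum T f n x)); last first.
  by apply/funext => n; rewrite -(birkhoff_sum_shift T f n) /= subrKA.
apply: (eqo_seqD _ IH); apply: eqo_seqD; first exact: fn_small.
exact/eqo_seqN/f_small.
Qed.

(* If r does not tend to infinity then f vanishes almost everywhere: along a
   subsequence with r bounded, f o T^n tends to 0, but all the f o T^n have the
   same distribution. *)
Lemma cst_eqo_ae (R : realType) (d : measure_display) (X : measurableType d)
    (m : probability X R) (T : {mfun X >-> X}) (f : {mfun X >-> R})
    (r : nat -> R) :
  measure_preserving m T -> (forall n, 0 < r n) ->
  {ae m, forall x, (fun n => f (iter n T x)) =o_\oo r} ->
  {ae m, forall x, (fun=> f x) =o_\oo r}.
Proof.
move=> T_preserving r_gt0 f_small.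
have [r_infty|] := pselect (forall M, \forall n \near \oo, M <= r n).
  apply: aeW => x; apply/eqo_seqP => e e0.
  apply: filterS (r_infty (`|f x| / e)) => n rn.
  by rewrite (gtr0_norm (r_gt0 n)) mulrC -ler_pdivrMr.
move=> /existsNP[M rM].
have {}rM n : exists2 k, (n <= k)%N & r k < M.
  apply: contrapT => nex; apply: rM; exists n => // k /= nk.
  by rewrite leNgt; apply/negP => rkM; apply: nex; exists k.
have M0 : 0 < M by have [k _] := rM 0%N; apply: lt_trans.
suff f0 : {ae m, forall x, forall j : nat, `|f x| < j.+1%:R^-1}.
  apply: filterS f0 => x fx; have -> : f x = 0.
    apply/normr0_eq0/eqP; rewrite eq_le normr_ge0 andbT leNgt.
    apply/negP => fx0; have := fx (Num.truncn `|f x|^-1).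
    rewrite ltNge => /negP; apply.
    by rewrite invf_ple ?posrE// ltW// truncnS_gt.
  apply/eqo_seqP => e e0; apply: nearW => n.
  by rewrite normr0 mulr_ge0// ltW.
apply/ae_foralln => j; set eps : R := j.+1%:R^-1.
have eps0 : 0 < eps by rewrite invr_gt0.
pose E := [set x | eps <= `|f x|].
have mE : measurable E.
  rewrite -(setTI E); apply: measurable_fun_le => //.
  exact: measurableT_comp.
(* Only times with [r k < M] count, and there are infinitely many; at each of them [A k] has the
   measure of [E]. *)
pose A k := if r k < M then iter k T @^-1` E else set0.
have mA k : measurable (A k).
  by rewrite /A; case: ifPn => // _; exact: measurable_preimage_iter.
have EA : (m E <= m (lim_sup_set A))%E.
  apply: measure_lim_sup_set_ge => // n; have [k nk rk] := rM n.
  by exists k => //; rewrite /A rk measure_preimage_iter.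
have A0 : m (lim_sup_set A) = 0%E.
  apply: measure_negligible.
    by apply: bigcap_measurable => // n _; exact: bigcup_measurable.
  apply: negligibleS f_small => x Ax /= /eqo_seqP fx.
  (* With tolerance [eps / M], at a late time with [r k < M] the value of [f] is below [eps] in
     absolute value, contradicting membership in [E]. *)
  have [|N _ HN] := fx (eps / M); first by rewrite divr_gt0.
  have [k /= Nk] := Ax N I; rewrite /A; case: ifPn => // rk; rewrite /E /= leNgt.
  apply/negP/negPn; apply: le_lt_trans (HN k Nk) _.
  by rewrite (gtr0_norm (r_gt0 k)) -mulrA gtr_pMr// mulrC ltr_pdivrMr// mul1r.
exists E; split => //.
- by apply/eqP; rewrite -measure_le0 -A0.
- by move=> x /negP; rewrite -leNgt.
Qed.

(** * Transfer of the limit theorem from [m] to [m'] *)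

Theorem corollary1p3 (R : realType)
    (d : measure_display) (X : measurableType d)
    (m : probability X R) (T : {mfun X >-> X})
    (T_preserving : measure_preserving m T) (T_ergodic : ergodic m T)
    (f : {mfun X >-> R})
    (r : nat -> R) (r_gt0 : forall n : nat, 0 < r n)
    (dW : measure_display) (Omega : measurableType dW)
    (PW : probability Omega R) (W : nat -> {mfun Omega >-> R})
    (m_limit : almost_sure_limit_theorem m PW (birkhoff_sum T f) W r)
    (m' : probability X R) (m'_ac : m' `<< m)
    (f_small : {ae m, forall x : X, (fun n : nat => f (iter n T x)) =o_\oo r}) :
  almost_sure_limit_theorem m' PW (birkhoff_sum T f) W r.
Proof.
have [P [P_coupling P_limit]] := m_limit.
have [g [ig g0 gE]] : exists g : X -> R,
    [/\ m.-integrable setT (EFin \o g), forall x, 0 <= g x &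
        forall A, measurable A -> m' A = (\int[m]_(x in A) (g x)%:E)%E].
  pose h := Radon_Nikodym_SigmaFinite.f m' m.
  have hE : EFin \o (fine \o h) = h.
    by apply/funext => x /=; rewrite fineK// Radon_Nikodym_SigmaFinite.f_fin_num.
  exists (fine \o h); rewrite hE; split.
  - exact: Radon_Nikodym_SigmaFinite.f_integrable.
  - by move=> x /=; rewrite fine_ge0// Radon_Nikodym_SigmaFinite.f_ge0.
  - move=> A mA; rewrite (Radon_Nikodym_SigmaFinite.f_integral m'_ac)//.
    by apply: eq_integral => x _; rewrite -[in LHS]/(h x) -[in LHS]hE.
have g1 : (\int[m]_x (g x)%:E = 1)%E by rewrite -gE// probability_setT.
have [rho [mrho rho0 rho1 rhoE]] :=
  filling_scheme T_preserving T_ergodic ig g0 g1.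
have rho_m' A : measurable A ->
    (\sum_(0 <= k <oo) \int[m]_(x in iter k T @^-1` A) (rho k x)%:E = m' A)%E.
  by move=> mA; rewrite rhoE// gE.
have [P' [P'_coupling P'0]] :=
  shift_coupling_exists P_coupling mrho rho0 rho1 rho_m'.
exists P'; split => //.
pose G := [set z : X * Omega |
  (fun n => `|birkhoff_sum T f n z.1 - W n z.2|) =o_\oo r].
have mG : measurable G.
  apply: measurable_eqo_seq => n; apply: measurableT_comp => //.
  apply: measurable_funB.
    rewrite /birkhoff_sum; apply: measurable_sum => k.
    apply: measurableT_comp => //.
    exact: measurableT_comp (measurable_iter T k) measurable_fst.
  exact: measurableT_comp measurable_snd.
exists (~` G); split => //; first exact: measurableC.
(* It remains to show, for each fixed [k], that [P]-almost every point lands in [G] after [k] shifts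
   of its first coordinate. *)
apply: P'0 => [|k]; first exact: measurableC.
apply: measure_negligible.
  rewrite -(setTI (_ @^-1` _)).
  by apply: measurable_iter_fst => //; exact: measurableC.
have fn_small := ae_iter T_preserving f_small.
have f_cst_small := ae_iter T_preserving (cst_eqo_ae T_preserving r_gt0 f_small).
have good : {ae P, forall z,
    (forall k, (fun n => f (iter n T (iter k T z.1))) =o_\oo r) /\
    (forall k, (fun=> f (iter k T z.1)) =o_\oo r)}.
  apply: (ae_coupling_fst P_coupling (Q := fun x =>
    (forall k, (fun n => f (iter n T (iter k T x))) =o_\oo r) /\
    (forall k, (fun=> f (iter k T x)) =o_\oo r))).
  by apply: filterS2 fn_small f_cst_small => x.
(* Split the error at the shifted point into the change of the Birkhoff sum from [x] to
   [iter k T x], which is small by [good], and the original error, small by [P_limit]. *)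
have : {ae P, forall z, G (iter_fst T k z)}.
  apply: filterS2 good P_limit => z [z1 z2] /eqo_seq_norm Gz.
  apply/eqo_seq_norm => /=.
  have := eqo_seqD (birkhoff_sum_iter_eqo z1 z2 k) Gz.
  by under eq_fun do rewrite addrA subrK.
by apply: negligibleS => z.
Qed.
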